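(* Let $P$ be a set of cardinality $d$, and let $$A=\sum_{i\in P}\alpha(i)|a_i\rangle\langle a_i|,\qquad B=\sum_{j\in P}\beta(j)|b_j\rangle\langle b_j|$$ be spectral decompositions of two Hermitian matrices in orthonormal bases $(a_i)_{i\in P}$ and $(b_j)_{j\in P}$, with $\alpha,\beta:P\to\mathbb{R}$. Set $C_{ij}:=\langle a_i,b_j\rangle$. Then for all $k\in\{1,\dots,d\}$, $$\lambda_{[k]}(A+B)\le\max_{S,T\in\binom{P}{k}}\big\{\alpha(S)+\beta(T)\;\big|\;\det C_{S,T}\ne0\big\}.$$
   Context: $\binom{P}{k}$ is the set of $k$-element subsets of $P$. For $f:P\to\mathbb{R}$ and $S\subseteq P$, $f(S):=\sum_{x\in S}f(x)$. $C_{S,T}$ is the submatrix of $C$ with rows indexed by $S$ and columns by $T$ (whether its determinant vanishes does not depend on how $S$ and $T$ are enumerated). For a Hermitian matrix $X$, $\lambda_{[k]}(X)$ is the sum of its $k$ largest eigenvalues (with multiplicity). *)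

(* Defs.v *)
From HB Require Import structures.
From mathcomp Require Import all_boot all_order all_algebra.
From mathcomp Require Import spectral complex.
From mathcomp Require Import reals constructive_ereal.

Set Implicit Arguments.
Unset Strict Implicit.
Unset Printing Implicit Defensive.

Import Order.TTheory GRing.Theory Num.Theory.

Local Open Scope ring_scope.
Local Open Scope sesquilinear_scope.
Local Open Scope complex_scope.

(* Conjugate-linear in the first argument. *)
Definition inner (R : realType) (d : nat) (u v : 'cV[R[i]]_d) : R[i] := (u ^t* *m v) 0 0.

Definition ketbra (R : realType) (d : nat) (u v : 'cV[R[i]]_d) : 'M[R[i]]_d := u *m v ^t*.

Definition orthonormal_family (R : realType) (d : nat) (P : finType) (a : P -> 'cV[R[i]]_d) :=
  forall i j : P, inner (a i) (a j) = (i == j)%:R.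

(* All roots of the characteristic polynomial, repeated according to their
   multiplicity; see eigenvaluesE. *)
Definition eigenvalues (R : realType) (d : nat) (X : 'M[R[i]]_d) : seq R[i] :=
  sval (closed_field_poly_normal (char_poly X)).

Lemma eigenvaluesE (R : realType) (d : nat) (X : 'M[R[i]]_d) :
  char_poly X = \prod_(z <- eigenvalues X) ('X - z%:P).
Proof.
rewrite /eigenvalues; case: closed_field_poly_normal => s /= ->.
by rewrite (monicP (char_poly_monic X)) scale1r.
Qed.

Lemma size_eigenvalues (R : realType) (d : nat) (X : 'M[R[i]]_d) : size (eigenvalues X) = d.
Proof.
by apply: succn_inj; rewrite -(size_char_poly X) eigenvaluesE size_prod_XsubC.
Qed.

Lemma hermitian_eigenvalues_real (R : realType) (d : nat) (X : 'M[R[i]]_d) (z : R[i]) :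
  X \is hermsymmx -> z \in eigenvalues X -> z = (complex.Re z)%:C.
Proof.
move=> hX zX.
have /eigenvalueP[v vX v0] : eigenvalue X z.
  by rewrite eigenvalue_root_char eigenvaluesE root_prod_XsubC.
have HX : X ^t* = X by move/is_hermitianmxP: hX => {2}->; rewrite expr0 scale1r.
have nz : (v *m v ^t*) 0 0 != 0
  by rewrite -dotmxE gt_eqF ?dotmx_is_dotmx.
have /(mulIf nz) : z * (v *m v ^t*) 0 0 = z^* * (v *m v ^t*) 0 0.
  transitivity ((v *m X *m v ^t*) 0 0); first by rewrite vX -scalemxAl [RHS]mxE.
  rewrite -{1}HX -mulmxA.
  have -> : X ^t* *m v ^t* = (v *m X) ^t* by rewrite trmx_mul map_mxM.
  by rewrite vX linearZ /= map_mxZ -scalemxAr [LHS]mxE.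
case: z {zX vX} => x y [] /eqP.
by rewrite eq_sym eqNr => /eqP->.
Qed.

(* Sum of the k largest eigenvalues of a Hermitian X: its eigenvalues are real
   (hermitian_eigenvalues_real), so taking real parts loses nothing. *)
Definition lambda_sum (R : realType) (d : nat) (k : nat) (X : 'M[R[i]]_d) : R :=
  \sum_(x <- take k (sort >=%R [seq complex.Re z | z <- eigenvalues X])) x.

Definition ksubset (P : finType) (k : nat) := {S : {set P} | #|S| == k}.

(* The S x T submatrix of a P x P array, the elements of S and T being listed
   in the order of enum. *)
Definition ksubset_nth (P : finType) (k : nat) (S : ksubset P k) (i : 'I_k) : P :=
  enum_val (cast_ord (esym (eqP (valP S))) i).

Definition subarray (K : Type) (P : finType) (k : nat) (C : P -> P -> K)
    (S T : ksubset P k) : 'M[K]_k :=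
  \matrix_(i < k, j < k) C (ksubset_nth S i) (ksubset_nth T j).

(* Main.v *)
Require Import Defs.
From mathcomp Require Import all_boot all_order all_fingroup all_algebra.
From mathcomp Require Import spectral complex.
From mathcomp Require Import reals constructive_ereal.

(** Let [v_1, ..., v_k] be orthonormal eigenvectors of [A + B] for its [k] largest
    eigenvalues.  The minors [x_f = det <a_{f i}, v_l>] and [y_g = det <b_{g j}, v_l>],
    indexed by maps ['I_k -> P] instead of [k]-subsets (whence the factors [k!]), are the
    coordinates of [v_1 /\ ... /\ v_k] in the bases of the exterior power given by [a]
    and [b], and
    [k! * lambda_sum k (A + B) = \sum_f alpha(f) |x_f|^2 + \sum_g beta(g) |y_g|^2].
    The change of basis is the [k]-th compound of [C].  If [alpha(f) + beta(g) <= m]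
    whenever [det C_{f,g} <> 0], then it maps the span of the [a_f] with [alpha(f) >= t]
    into the span of the [b_g] with [m - beta(g) >= t], so the [|x|^2]-mass of the former
    is at most the [|y|^2]-mass of the latter, for every [t].  Summing over the layers [t]
    gives [\sum_f alpha(f) |x_f|^2 <= \sum_g (m - beta(g)) |y_g|^2], that is,
    [lambda_sum k (A + B) <= m]. *)

Set Implicit Arguments.
Unset Strict Implicit.
Unset Printing Implicit Defensive.

Import Order.TTheory GRing.Theory Num.Theory.

Local Open Scope ring_scope.
Local Open Scope sesquilinear_scope.

(** * Minors indexed by maps and the Cauchy-Binet formula *)

Section Minors.
Variables (K : comNzRingType) (k : nat).

(** Repeated indices are allowed and give 0; an injective map amounts to a [k]-subset with an
    ordering. *)
Definition minor (I J : Type) (F : I -> J -> K) (f : 'I_k -> I) (g : 'I_k -> J) : K :=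
  \det (\matrix_(i < k, j < k) F (f i) (g j)).

Lemma eq_minor (I J : Type) (F F' : I -> J -> K) (f f' : 'I_k -> I) (g g' : 'I_k -> J) :
  F =2 F' -> f =1 f' -> g =1 g' -> minor F f g = minor F' f' g'.
Proof. by move=> eF ef eg; congr (\det _); apply/matrixP=> i j; rewrite !mxE eF ef eg. Qed.

Lemma minor_perml (I J : Type) (F : I -> J -> K) (f : 'I_k -> I) (g : 'I_k -> J) (s : 'S_k) :
  minor F (f \o s) g = (-1) ^+ s * minor F f g.
Proof.
rewrite /minor -det_perm -det_mulmx -row_permE; congr (\det _).
by apply/matrixP=> i j; rewrite !mxE.
Qed.

Lemma minor_tr (I J : Type) (F : I -> J -> K) (f : 'I_k -> I) (g : 'I_k -> J) :
  minor (fun j i => F i j) g f = minor F f g.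
Proof. by rewrite /minor -det_tr; congr (\det _); apply/matrixP=> i j; rewrite !mxE. Qed.

Lemma minor_permr (I J : Type) (F : I -> J -> K) (f : 'I_k -> I) (g : 'I_k -> J) (s : 'S_k) :
  minor F f (g \o s) = (-1) ^+ s * minor F f g.
Proof. by rewrite -minor_tr minor_perml minor_tr. Qed.

Lemma minor_neq0_inj (I J : eqType) (F : I -> J -> K) (f : 'I_k -> I) (g : 'I_k -> J) :
  minor F f g != 0 -> injective f.
Proof.
move=> nz i j fij; apply/eqP; apply: contraNT nz => ij.
by apply/eqP/(determinant_alternate ij) => l; rewrite !mxE fij.
Qed.

(** Multilinearity in the rows: row [i] on the right combines rows of [G] with coefficients
    [u i]. *)
Lemma sum_prod_minor (P L : finType) (u : 'I_k -> P -> K) (G : P -> L -> K) (h : 'I_k -> L) :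
  \sum_(g : {ffun 'I_k -> P}) (\prod_i u i (g i)) * minor G g h =
  \det (\matrix_(i < k, j < k) \sum_p u i p * G p (h j)).
Proof.
rewrite /minor /determinant.
under [RHS]eq_bigr => s _.
  under eq_bigr => i _ do rewrite mxE.
  rewrite bigA_distr_bigA /= mulr_sumr; over.
rewrite exchange_big /=; apply: eq_bigr => g _.
rewrite mulr_sumr; apply: eq_bigr => s _.
rewrite big_split /= mulrCA; congr (_ * (_ * _)).
by apply: eq_bigr => i _; rewrite mxE.
Qed.

(* Each of the [k!] terms of the Leibniz expansion of the first minor
   contributes equally, after reindexing [g]. *)
Lemma sum_minor_minor (I P L : finType) (w : {ffun 'I_k -> P} -> K)
    (F : I -> P -> K) (G : P -> L -> K) (f : 'I_k -> I) (h : 'I_k -> L) :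
  (forall (g : {ffun 'I_k -> P}) (s : 'S_k), w [ffun i => g (s i)] = w g) ->
  \sum_(g : {ffun 'I_k -> P}) w g * (minor F f g * minor G g h) =
  k`!%:R * \sum_(g : {ffun 'I_k -> P}) w g * ((\prod_i F (f i) (g i)) * minor G g h).
Proof.
move=> wS; rewrite {1}/minor /determinant.
under eq_bigr => g _ do rewrite mulr_suml mulr_sumr.
rewrite exchange_big /=.
rewrite -card_Sn mulr_natl -sumr_const.
apply: eq_big => [s|s _]; first by rewrite inE.
pose act (t : 'S_k) (g : {ffun 'I_k -> P}) := [ffun i => g (t i)].
rewrite (reindex (act s^-1%g)) /=; last first.
  by exists (act s) => g _; apply/ffunP=> i; rewrite !ffunE ?permK ?permKV //.
apply: eq_bigr => g _; rewrite wS; congr (_ * _).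
rewrite -mulrA mulrCA; congr (_ * _).
  by apply: eq_bigr => i _; rewrite mxE ffunE permK.
(* Permuting the rows of the second minor yields a sign that cancels the Leibniz sign of the
   first. *)
rewrite (@eq_minor _ _ G G _ (g \o s^-1%g) h h) //; last by move=> i; rewrite ffunE.
by rewrite minor_perml odd_permV mulrA -signr_addb addbb mul1r.
Qed.

Lemma Cauchy_Binet (I P L : finType) (F : I -> P -> K) (G : P -> L -> K)
    (f : 'I_k -> I) (h : 'I_k -> L) :
  \sum_(g : {ffun 'I_k -> P}) minor F f g * minor G g h =
  k`!%:R * minor (fun i l => \sum_p F i p * G p l) f h.
Proof.
under eq_bigr => g _ do rewrite -[X in X * _]mul1r -mulrA.
rewrite (@sum_minor_minor _ _ _ (fun=> 1)) //; congr (_ * _).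
under eq_bigr => g _ do rewrite mul1r.
by rewrite (@sum_prod_minor _ _ (fun i p => F (f i) p)).
Qed.

Lemma det_set_row1 (r : 'I_k -> K) (i0 : 'I_k) :
  \det (\matrix_(i < k, j < k) if i == i0 then r j else (i == j)%:R) = r i0.
Proof.
rewrite (expand_det_row _ i0).
(* Cofactors along row [i0] do not see that row, so they are those of the identity matrix. *)
have adjE j : cofactor (\matrix_(i, j) if i == i0 then r j else (i == j)%:R) i0 j = (j == i0)%:R.
  have := adj1 K k => /matrixP/(_ j i0); rewrite !mxE => <-.
  rewrite /cofactor; congr (_ * \det _); apply/matrixP=> i l; rewrite !mxE.
  by rewrite eq_sym (negbTE (neq_lift _ _)).
under eq_bigr => j _ do rewrite adjE mxE eqxx.
rewrite (bigD1 i0) //= eqxx mulr1 big1 ?addr0 // => j /negbTE->.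
by rewrite mulr0.
Qed.

(* The infinitesimal form of Cauchy-Binet: the additive weight turns the
   determinant into a trace. *)
Lemma sum_weight_minor (I P L : finType) (w : P -> K)
    (F : I -> P -> K) (G : P -> L -> K) (f : 'I_k -> I) (h : 'I_k -> L) :
  (forall i j, \sum_p F (f i) p * G p (h j) = (i == j)%:R) ->
  \sum_(g : {ffun 'I_k -> P}) (\sum_i w (g i)) * (minor F f g * minor G g h) =
  k`!%:R * \sum_i \sum_p w p * (F (f i) p * G p (h i)).
Proof.
move=> FG1.
rewrite (@sum_minor_minor _ _ _ (fun g => \sum_i w (g i))); last first.
  move=> g s; rewrite [RHS](reindex_inj (@perm_inj _ s)).
  by apply: eq_bigr => i _; rewrite ffunE.
congr (_ * _).
under eq_bigr => g _ do rewrite mulr_suml.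
rewrite exchange_big /=; apply: eq_bigr => i0 _.
(* The weight of [g i0] is absorbed into row [i0]; by [FG1] the other rows become those of the
   identity. *)
pose u i p := (if i == i0 then w p else 1) * F (f i) p.
transitivity (\sum_(g : {ffun 'I_k -> P}) (\prod_i u i (g i)) * minor G g h).
  apply: eq_bigr => g _; rewrite mulrA; congr (_ * _).
  rewrite /u big_split /=; congr (_ * _).
  by rewrite (bigD1 i0) //= eqxx big1 ?mulr1 // => i /negbTE->.
rewrite sum_prod_minor.
rewrite -[RHS](det_set_row1 (fun j => \sum_p w p * (F (f i0) p * G p (h j))) i0).
congr (\det _); apply/matrixP=> i j; rewrite !mxE /u.
case: eqP => [->|_]; first by apply: eq_bigr => p _; rewrite mulrA.
by rewrite -FG1; apply: eq_bigr => p _; rewrite mul1r.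
Qed.

End Minors.

(** * Adjoints and partial isometries *)

Lemma conj_minor (K : numClosedFieldType) (k : nat) (I J : Type) (F : I -> J -> K)
    (f : 'I_k -> I) (g : 'I_k -> J) :
  (minor F f g)^* = minor (fun i j => (F i j)^*) f g.
Proof. by rewrite /minor -det_map_mx; congr (\det _); apply/matrixP=> i j; rewrite !mxE. Qed.

Lemma sum_adjoint (K : numClosedFieldType) (I J : finType) (M : I -> J -> K)
    (u : I -> K) (w : J -> K) :
  \sum_i (u i)^* * (\sum_j M i j * w j) = \sum_j (\sum_i (M i j)^* * u i)^* * w j.
Proof.
under eq_bigr do rewrite mulr_sumr.
rewrite exchange_big /=; apply: eq_bigr => j _.
rewrite rmorph_sum mulr_suml; apply: eq_bigr => i _.
by rewrite rmorphM /= conjCK mulrA [_^* * M i j]mulrC.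
Qed.

Section PartialIsometry.
Variables (K : numClosedFieldType) (I J : finType) (M : I -> J -> K).
(** That is, [M M^* M = M]: over maps instead of subsets, the compound of a unitary matrix is
    isometric only on alternating functions, hence a partial isometry. *)
Hypothesis MMM : forall i j, \sum_j' \sum_i' M i j' * (M i' j')^* * M i' j = M i j.

(** With [v = M M^* u], the hypothesis makes [<u,v>], [<v,u>] and [<v,v>] all equal to [|M^* u|^2],
    so [0 <= |u - v|^2] is the claim. *)
Lemma adjoint_contraction (u : I -> K) :
  \sum_j `|\sum_i (M i j)^* * u i| ^+ 2 <= \sum_i `|u i| ^+ 2.
Proof.
pose w j := \sum_i (M i j)^* * u i; pose v i := \sum_j M i j * w j.
set N := \sum_j _.
have NE : N = \sum_j (w j)^* * w j by apply: eq_bigr => j _; rewrite normCKC.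
have uv : \sum_i (u i)^* * v i = N by rewrite sum_adjoint NE.
have Nreal : N^* = N.
  by rewrite conj_Creal // ger0_real // sumr_ge0 // => j _; rewrite exprn_ge0.
have vu : \sum_i (v i)^* * u i = N.
  rewrite -Nreal -uv rmorph_sum; apply: eq_bigr => i _.
  by rewrite rmorphM /= conjCK mulrC.
have vv : \sum_i (v i)^* * v i = N.
  rewrite sum_adjoint NE; apply: eq_bigr => j _; congr (_^* * _).
  rewrite /v /w.
  transitivity (\sum_i' (\sum_j' \sum_i M i' j' * (M i j')^* * M i j)^* * u i'); last first.
    by apply: eq_bigr => i _; rewrite MMM.
  under eq_bigr => i _ do rewrite mulr_sumr.
  under eq_bigr => i _ do under eq_bigr => j' _ do rewrite !mulr_sumr.
  under eq_bigr => i _ do rewrite exchange_big /=.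
  rewrite exchange_big /=; apply: eq_bigr => i' _.
  rewrite exchange_big rmorph_sum mulr_suml; apply: eq_bigr => j' _.
  rewrite rmorph_sum mulr_suml; apply: eq_bigr => i _.
  rewrite !rmorphM /= conjCK !mulrA; congr (_ * _).
  by rewrite [LHS]mulrC -[RHS]mulrA [M i j' * _]mulrC.
have : 0 <= \sum_i `|u i - v i| ^+ 2 by rewrite sumr_ge0 // => i _; rewrite exprn_ge0.
under eq_bigr => i _ do rewrite normCKC rmorphB /= mulrBl !mulrBr.
rewrite !sumrB uv vu vv subrr subr0 subr_ge0.
by under [X in _ <= X -> _]eq_bigr => i _ do rewrite -normCKC.
Qed.

(** Cut [x] to [u] on [A] and [y] to [z] on [B]. Then [w = M^* u] lives on [B], so
    [|u|^2 = <u, M y> = <w, z>]; with [|w|^2 <= |u|^2], the inequality [0 <= |w - z|^2] gives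
    [|u|^2 <= |z|^2]. *)
Lemma superlevel_mass_le (x : I -> K) (y : J -> K) (A : pred I) (B : pred J) :
  (forall i, x i = \sum_j M i j * y j) ->
  (forall i j, A i -> M i j != 0 -> B j) ->
  \sum_(i | A i) `|x i| ^+ 2 <= \sum_(j | B j) `|y j| ^+ 2.
Proof.
move=> xE AB.
pose u i := if A i then x i else 0; pose w j := \sum_i (M i j)^* * u i.
pose z j := if B j then y j else 0.
have wB j : ~~ B j -> w j = 0.
  move=> nB; rewrite /w big1 // => i _; rewrite /u; case: ifP => [Ai|_]; last by rewrite mulr0.
  have /eqP-> : M i j == 0 by apply: contraNT nB; apply: AB.
  by rewrite conjC0 mul0r.
have uE : \sum_(i | A i) `|x i| ^+ 2 = \sum_i `|u i| ^+ 2.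
  rewrite big_mkcond; apply: eq_bigr => i _; rewrite /u; case: ifP => // _.
  by rewrite normr0 expr0n.
have zE : \sum_(j | B j) `|y j| ^+ 2 = \sum_j `|z j| ^+ 2.
  rewrite big_mkcond; apply: eq_bigr => i _; rewrite /z; case: ifP => // _.
  by rewrite normr0 expr0n.
rewrite {}uE {}zE; set U := \sum_i _; set Z := \sum_j _.
have UE : U = \sum_j (w j)^* * z j.
  transitivity (\sum_i (u i)^* * x i).
    apply: eq_bigr => i _; rewrite normCKC /u; case: ifP => // _.
    by rewrite conjC0 !mul0r.
  under eq_bigr => i _ do rewrite xE.
  rewrite sum_adjoint; apply: eq_bigr => j _; rewrite -/(w j) /z.
  by case: ifP => // /negbT/wB ->; rewrite conjC0 !mul0r.
have Ureal : U^* = U.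
  by rewrite conj_Creal // ger0_real // sumr_ge0 // => i _; rewrite exprn_ge0.
have UE' : U = \sum_j (z j)^* * w j.
  by rewrite -Ureal UE rmorph_sum; apply: eq_bigr => j _; rewrite rmorphM /= conjCK mulrC.
have : 0 <= \sum_j `|w j - z j| ^+ 2 by rewrite sumr_ge0 // => i _; rewrite exprn_ge0.
under eq_bigr => i _ do rewrite normCKC rmorphB /= mulrBl !mulrBr.
rewrite !sumrB -UE -UE' => WZ.
have W : \sum_j (w j)^* * w j <= U.
  by under eq_bigr => j _ do rewrite -normCKC; apply: adjoint_contraction.
have ZE : Z = \sum_j (z j)^* * z j by apply: eq_bigr => j _; rewrite normCKC.
rewrite -ZE in WZ.
rewrite -subr_ge0; apply: (le_trans WZ).
by rewrite opprB gerDr subr_le0.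
Qed.

End PartialIsometry.

(** * Masses of minors and the compound of a matrix *)

Section CompoundMass.
Variables (K : numClosedFieldType) (k : nat) (P : finType).

Lemma normsq_minor (X : P -> 'I_k -> K) (f : 'I_k -> P) :
  `|minor X f id| ^+ 2 = minor (fun l p => (X p l)^*) id f * minor X f id.
Proof. by rewrite normCKC conj_minor -minor_tr. Qed.

Lemma total_mass (X : P -> 'I_k -> K) :
  (forall i j, \sum_p (X p i)^* * X p j = (i == j)%:R) ->
  \sum_(f : {ffun 'I_k -> P}) `|minor X f id| ^+ 2 = k`!%:R.
Proof.
move=> X1; under eq_bigr => f _ do rewrite normsq_minor.
rewrite Cauchy_Binet -[RHS]mulr1; congr (_ * _).
by rewrite -[RHS](@det1 _ k); congr (\det _); apply/matrixP=> i j; rewrite !mxE X1.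
Qed.

(** The double sum is the trace of the diagonal operator [w] compressed to the span of the columns
    of [X]. *)
Lemma weighted_mass (w : P -> K) (X : P -> 'I_k -> K) :
  (forall i j, \sum_p (X p i)^* * X p j = (i == j)%:R) ->
  \sum_(f : {ffun 'I_k -> P}) (\sum_i w (f i)) * `|minor X f id| ^+ 2 =
  k`!%:R * \sum_l \sum_p w p * ((X p l)^* * X p l).
Proof.
move=> X1; under eq_bigr => f _ do rewrite normsq_minor.
exact: (@sum_weight_minor _ _ _ _ _ w (fun l p => (X p l)^*) X id id).
Qed.

Lemma compound_mass_le (C : P -> P -> K) (X Y : P -> 'I_k -> K)
    (A B : pred {ffun 'I_k -> P}) :
  (forall p q, \sum_q' \sum_p' C p q' * (C p' q')^* * C p' q = C p q) ->
  (forall p l, X p l = \sum_q C p q * Y q l) ->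
  (forall f g : {ffun 'I_k -> P}, A f -> minor C f g != 0 -> B g) ->
  \sum_(f | A f) `|minor X f id| ^+ 2 <= \sum_(g | B g) `|minor Y g id| ^+ 2.
Proof.
move=> CCC XE AB.
have kf0 : k`!%:R != 0 :> K by rewrite pnatr_eq0 -lt0n fact_gt0.
(* Dividing by [k!] undoes the overcounting in Cauchy-Binet, so that compounds multiply as the
   matrices do. *)
pose M (f g : {ffun 'I_k -> P}) := k`!%:R^-1 * minor C f g.
have M_conj f g : (M f g)^* = k`!%:R^-1 * minor (fun q p => (C p q)^*) g f.
  by rewrite rmorphM /= fmorphV rmorph_nat conj_minor -minor_tr.
apply: (@superlevel_mass_le _ _ _ M) => [f g|f|f g Af]; last first.
- by rewrite mulf_eq0 negb_or => /andP[_]; apply: AB.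
- rewrite /M; under eq_bigr => g _ do rewrite -mulrA.
  by rewrite -mulr_sumr Cauchy_Binet mulKf //; apply: eq_minor.
(* [M M^* M] is the compound of [C C^* C], which is [C]. *)
under eq_bigr => g' _.
  under eq_bigr => f' _ do rewrite -mulrA M_conj /M [X in _ * X]mulrACA.
  rewrite -mulr_sumr -mulr_sumr Cauchy_Binet -[k`!%:R^-1 * k`!%:R^-1 * _]mulrA mulKf //.
  rewrite mulrACA; over.
rewrite -mulr_sumr Cauchy_Binet -mulrA mulKf //; congr (_ * _).
apply: eq_minor => // p q; rewrite -CCC; apply: eq_bigr => q' _.
by rewrite mulr_sumr; apply: eq_bigr => p' _; rewrite mulrA.
Qed.

End CompoundMass.

Local Open Scope complex_scope.

(** * Layer-cake summation over real levels *)

Section LayerCake.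
Variable R : realType.

(** Each pair in [l] is a gap between consecutive values together with its upper end; the gaps up to
    [v] telescope. *)
Lemma layer_cake_decomposition (t0 : R) (s : seq R) : path <%R t0 s ->
  exists2 l : seq (R * R), all (fun ct => (0 <= ct.1) && (t0 < ct.2)) l &
    forall v, v \in t0 :: s -> v = t0 + \sum_(ct <- l | ct.2 <= v) ct.1.
Proof.
elim: s t0 => [|t1 s IH] t0 /=.
  by move=> _; exists [::] => // v; rewrite inE => /eqP->; rewrite big_nil addr0.
case/andP=> t01 t1s; have [l lP lE] := IH _ t1s.
have l0 : all (fun ct => (0 <= ct.1) && (t0 < ct.2)) l.
  by apply: sub_all lP => -[c t] /= /andP[-> /(lt_trans t01)].
exists ((t1 - t0, t1) :: l) => [|v] /=; first by rewrite subr_ge0 ltW // t01.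
rewrite inE big_cons /= => /orP[/eqP->|vs].
  rewrite leNgt t01 /= big_seq_cond big1 ?addr0 // => ct /andP[ctl].
  by have /andP[_ /lt_geF->] := allP l0 _ ctl.
have t1v : t1 <= v.
  by move: vs; rewrite inE => /orP[/eqP->//|/(allP (order_path_min lt_trans t1s))/ltW].
by rewrite t1v addrA [t0 + _]addrC subrK; apply: lE.
Qed.

Lemma layer_cake_le (I J : finType) (h : I -> R) (h' : J -> R) (p : I -> R[i]) (q : J -> R[i]) :
  (forall t, \sum_(i | t <= h i) p i <= \sum_(j | t <= h' j) q j) ->
  \sum_i p i = \sum_j q j ->
  \sum_i (h i)%:C * p i <= \sum_j (h' j)%:C * q j.
Proof.
move=> pq tot.
(* The levels are all values of [h] and [h'], so one list of gaps serves both sums. *)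
pose s := sort <=%R (undup (codom h ++ codom h')).
have hs i : h i \in s by rewrite mem_sort mem_undup mem_cat codom_f.
have hs' j : h' j \in s by rewrite mem_sort mem_undup mem_cat codom_f orbT.
have : sorted <%R s by rewrite sort_lt_sorted undup_uniq.
case: s hs hs' => [hs hs' _|t0 s hs hs' /layer_cake_decomposition[l lP lE]].
  (* Without any value both index types are empty. *)
  by rewrite !big1 // => [j|i]; [have := hs' j | have := hs i].
have cake (T : finType) (g : T -> R) (w : T -> R[i]) : (forall x, g x \in t0 :: s) ->
    \sum_x (g x)%:C * w x =
    t0%:C * \sum_x w x + \sum_(ct <- l) ct.1%:C * \sum_(x | ct.2 <= g x) w x.
  move=> gs; under [X in _ = _ + X]eq_bigr => ct _ do rewrite mulr_sumr big_mkcond /=.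
  rewrite exchange_big mulr_sumr -big_split /=; apply: eq_bigr => x _.
  rewrite {1}(lE _ (gs x)) rmorphD mulrDl rmorph_sum mulr_suml /=; congr (_ + _).
  by rewrite big_mkcond.
(* The bottom level [t0] is matched by the equal totals, the layers above it by [pq]. *)
rewrite !cake // tot lerD2l big_seq [leRHS]big_seq; apply: ler_sum => ct /(allP lP)/andP[c0 _].
by rewrite ler_wpM2l ?ler0c.
Qed.

End LayerCake.

(** * Orthonormal bases and top eigenvectors *)

Lemma char_poly_conjugate (K : comNzRingType) (n : nat) (U V A : 'M[K]_n) :
  V *m U = 1%:M -> char_poly (V *m A *m U) = char_poly A.
Proof.
move=> VU; rewrite /char_poly.
have VU' : map_mx polyC V *m map_mx polyC U = 1%:M :> 'M[{poly K}]_n.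
  by rewrite -map_mxM VU map_mx1.
have -> : char_poly_mx (V *m A *m U) = map_mx polyC V *m char_poly_mx A *m map_mx polyC U.
  by rewrite /char_poly_mx mulmxBr mulmxBl !map_mxM mul_mx_scalar -scalemxAl VU' scalemx1.
by rewrite !det_mulmx mulrAC -det_mulmx VU' det1 mul1r.
Qed.

Section TopEigenvectors.
Variable R : realType.

Lemma inner_conj (d : nat) (u v : 'cV[R[i]]_d) : (inner u v)^*%R = inner v u.
Proof.
rewrite /inner !mxE rmorph_sum; apply: eq_bigr => i _.
by rewrite !mxE rmorphM /= conjCK mulrC.
Qed.

Lemma inner_sum_ketbra (d : nat) (T : finType) (w : T -> R[i]) (e : T -> 'cV[R[i]]_d)
    (u v : 'cV[R[i]]_d) :
  inner u ((\sum_t w t *: ketbra (e t) (e t)) *m v) =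
  \sum_t w t * (inner u (e t) * inner (e t) v).
Proof.
rewrite /inner mulmx_suml mulmx_sumr summxE; apply: eq_bigr => t _.
rewrite /ketbra -scalemxAl -scalemxAr mxE; congr (_ * _).
by rewrite !mulmxA -[_ *m _ *m _ *m _]mulmxA mxE big_ord1.
Qed.

Lemma orthonormal_resolution (d : nat) (T : finType) (e : T -> 'cV[R[i]]_d) :
  #|T| = d -> orthonormal_family e -> \sum_t ketbra (e t) (e t) = 1%:M.
Proof.
(* With [#|T|] in place of [d] the matrix [E] is square, so its left inverse is also a right
   inverse. *)
move=> Td one; move: e one; rewrite -Td => e one.
pose E := \matrix_(i < #|T|, j < #|T|) e (enum_val j) i 0.
have EE : E ^t* *m E = 1%:M.
  apply/matrixP=> i j; rewrite !mxE; have := one (enum_val i) (enum_val j).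
  rewrite (inj_eq enum_val_inj) => <-; rewrite /inner mxE.
  by apply: eq_bigr => l _; rewrite !mxE.
rewrite -(mulmx1C EE); apply/matrixP=> i j; rewrite summxE !mxE.
rewrite (reindex (@enum_val _ T)) /=; last by apply: onW_bij; apply: enum_val_bij.
by apply: eq_bigr => l _; rewrite /ketbra !mxE big_ord1 !mxE.
Qed.

Lemma inner_resolution (d : nat) (T : finType) (e : T -> 'cV[R[i]]_d) (u v : 'cV[R[i]]_d) :
  #|T| = d -> orthonormal_family e -> \sum_t inner u (e t) * inner (e t) v = inner u v.
Proof.
move=> Td one; rewrite -{2}[v]mul1mx -(orthonormal_resolution Td one).
under [in RHS]eq_bigr => t _ do rewrite -[ketbra _ _]scale1r.
by rewrite inner_sum_ketbra; apply: eq_bigr => t _; rewrite mul1r.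
Qed.

Lemma lambda_sum_eigenvectors (d k : nat) (X : 'M[R[i]]_d) :
  X \is hermsymmx -> (k <= d)%N ->
  exists2 v : 'I_k -> 'cV[R[i]]_d, orthonormal_family v &
    (lambda_sum k X)%:C = \sum_l inner (v l) (X *m v l).
Proof.
move=> hX kd.
pose U := spectralmx X; pose D := spectral_diag X.
have Uu : U \is unitarymx := spectral_unitarymx X.
have UU : U *m U ^t* = 1%:M by apply/unitarymxP.
have XE : X = U ^t* *m diag_mx D *m U.
  by rewrite -invmx_unitary //; apply/orthomx_spectralP/hermitian_normalmx.
have chX : char_poly X = \prod_(i < d) ('X - (D 0 i)%:P).
  rewrite XE char_poly_conjugate ?(mulmx1C UU) // char_poly_trig ?diag_mx_is_trig //.
  by apply: eq_bigr => i _; rewrite mxE eqxx mulr1n.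
have pe : perm_eq (eigenvalues X) [seq D 0 i | i <- enum 'I_d].
  by apply/prod_XsubC_eq; rewrite -eigenvaluesE chX big_map big_enum.
pose r i := complex.Re (D 0 i).
(* Sorting indices by eigenvalue keeps each eigenvector attached and respects multiplicity. *)
have sE : sort >=%R [seq complex.Re z | z <- eigenvalues X] =
    map r (sort (relpre r >=%R) (enum 'I_d)).
  rewrite -sort_map; apply/perm_sortP; [exact: ge_total|exact: ge_trans|exact: ge_anti|].
  by rewrite (map_comp (@complex.Re R) (fun i => D 0 i)) perm_map.
pose t := take k (sort (relpre r >=%R) (enum 'I_d)).
have st : size t == k by rewrite size_takel // size_sort size_enum_ord.
have ut : uniq t by rewrite take_uniq // sort_uniq enum_uniq.
pose rho := tnth (Tuple st).
have rho_inj : injective rho by apply/tuple_uniqP.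
have Dr i : (r i)%:C = D 0 i.
  by rewrite RRe_real //; have /mxOverP := hermitian_spectral_diag_real hX; apply.
(* As [X = U^* D U], the conjugate transposes of the rows of [U] are eigenvectors. *)
exists (fun l => (row (rho l) U) ^t*).
  move=> l m; rewrite /inner trmxCK -(inj_eq rho_inj).
  by have /matrixP/(_ (rho l) (rho m)) := UU; rewrite !mxE => <-; apply: eq_bigr => i _; rewrite !mxE.
have UXU : U *m X *m U ^t* = diag_mx D by rewrite XE !mulmxA UU mul1mx -mulmxA UU mulmx1.
rewrite /lambda_sum sE -map_take big_map -/t rmorph_sum -[t]/(val (Tuple st)) big_tuple /=.
apply: eq_bigr => l _; rewrite Dr /inner trmxCK mulmxA -!row_mul.
have /matrixP/(_ (rho l) (rho l)) := UXU; rewrite [RHS]mxE eqxx mulr1n => <-.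
by rewrite !mxE; apply: eq_bigr => i _; rewrite !mxE.
Qed.

End TopEigenvectors.

(** * The trace bound on an orthonormal frame *)

(** The left side is the trace, on the span of [v], of the operators with eigenvalues [alpha] and
    [beta]; layers are compared at the levels [alpha(f)] and [m - beta(g)]. *)
Lemma frame_trace_le (R : realType) (d : nat) (P : finType) (alpha beta : P -> R)
    (a b : P -> 'cV[R[i]]_d) (k : nat) (v : 'I_k -> 'cV[R[i]]_d) (m : R) :
  #|P| = d -> orthonormal_family a -> orthonormal_family b -> orthonormal_family v ->
  (forall f g : {ffun 'I_k -> P}, minor (fun p q => inner (a p) (b q)) f g != 0 ->
     \sum_i alpha (f i) + \sum_i beta (g i) <= m) ->
  \sum_l \sum_p (alpha p)%:C * (inner (v l) (a p) * inner (a p) (v l)) +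
  \sum_l \sum_p (beta p)%:C * (inner (v l) (b p) * inner (b p) (v l)) <= m%:C.
Proof.
move=> cardP ona onb onv Cm.
pose X p l := inner (a p) (v l); pose Y p l := inner (b p) (v l).
have X1 i j : \sum_p (X p i)^*%R * X p j = (i == j)%:R.
  by rewrite -onv -(inner_resolution _ _ cardP ona); apply: eq_bigr => p _; rewrite inner_conj.
have Y1 i j : \sum_p (Y p i)^*%R * Y p j = (i == j)%:R.
  by rewrite -onv -(inner_resolution _ _ cardP onb); apply: eq_bigr => p _; rewrite inner_conj.
pose x (f : {ffun 'I_k -> P}) := `|minor X f id| ^+ 2.
pose y (g : {ffun 'I_k -> P}) := `|minor Y g id| ^+ 2.
have xT : \sum_f x f = k`!%:R := total_mass X1.
have yT : \sum_f y f = k`!%:R := total_mass Y1.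
have mass_le (t : R) :
    \sum_(f : {ffun 'I_k -> P} | t <= \sum_i alpha (f i)) x f <=
    \sum_(g : {ffun 'I_k -> P} | t <= m - \sum_i beta (g i)) y g.
  apply: (@compound_mass_le _ _ _ (fun p q => inner (a p) (b q))) => [p q|p l|f g tf nz].
  - under eq_bigr => q' _.
      under eq_bigr => p' _ do rewrite inner_conj -mulrA.
      rewrite -mulr_sumr inner_resolution //; over.
    by rewrite inner_resolution.
  - by rewrite inner_resolution.
  - by apply: le_trans tf _; rewrite lerBrDr Cm.
have le_xy := layer_cake_le mass_le (etrans xT (esym yT)).
have xW : \sum_(f : {ffun 'I_k -> P}) (\sum_i alpha (f i))%:C * x f =
    k`!%:R * \sum_l \sum_p (alpha p)%:C * ((X p l)^*%R * X p l).
  rewrite -(weighted_mass _ X1); by apply: eq_bigr => f _; rewrite rmorph_sum.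
(* The total mass [k!] of [y] turns the constant [m] into [k! m]. *)
have yW : \sum_(f : {ffun 'I_k -> P}) (m - \sum_i beta (f i))%:C * y f =
    k`!%:R * (m%:C - \sum_l \sum_p (beta p)%:C * ((Y p l)^*%R * Y p l)).
  rewrite mulrBr -(weighted_mass _ Y1) [_ * m%:C]mulrC -yT mulr_sumr -sumrB.
  by apply: eq_bigr => f _; rewrite rmorphB rmorph_sum mulrBl.
move: le_xy; rewrite [X in X <= _]xW [X in _ <= X]yW ler_pM2l ?ltr0n ?fact_gt0 // lerBrDr.
by congr (_ + _ <= _); apply: eq_bigr => l _; apply: eq_bigr => p _; rewrite inner_conj.
Qed.

(** * From maps to [k]-subsets *)

(** [S] is the image of [f], and [s] compares the order given by [f] with that of [enum]; minors
    then change only by a sign. *)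
Lemma injective_ksubset_nth (P : finType) (k : nat) (f : 'I_k -> P) : injective f ->
  exists (S : ksubset P k) (s : 'S_k), f =1 ksubset_nth S \o s.
Proof.
move=> finj.
have cf : #|f @: 'I_k| == k by rewrite card_imset // card_ord.
pose S : ksubset P k := exist _ (f @: 'I_k) cf.
have fS i : {j | ksubset_nth S j = f i}.
  have fi : f i \in f @: 'I_k by apply: imset_f.
  exists (cast_ord (eqP cf) (enum_rank_in fi (f i))).
  rewrite /ksubset_nth; set c := cast_ord _ _.
  have -> : c = enum_rank_in fi (f i) by apply: val_inj.
  by rewrite enum_rankK_in.
have sinj : injective (fun i => sval (fS i)).
  by move=> i j eij; apply: finj; rewrite -(svalP (fS i)) eij (svalP (fS j)).
by exists S, (perm sinj) => i /=; rewrite permE; case: (fS i).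
Qed.

Lemma sum_ksubset_nth (R : nmodType) (P : finType) (k : nat) (S : ksubset P k) (w : P -> R) (s : 'S_k) :
  \sum_i w (ksubset_nth S (s i)) = \sum_(p in val S) w p.
Proof.
transitivity (\sum_i w (ksubset_nth S i)); first by rewrite [RHS](reindex_perm s).
rewrite [RHS]big_enum_val /=.
rewrite (reindex (cast_ord (esym (eqP (valP S))))) //.
by apply: onW_bij; exists (cast_ord (eqP (valP S))); [apply: cast_ordKV|apply: cast_ordK].
Qed.

Theorem lemma2 (R : realType) (d : nat) (P : finType) (cardP : #|P| = d)
    (A B : 'M[R[i]]_d) (alpha beta : P -> R) (a b : P -> 'cV[R[i]]_d)
    (C : P -> P -> R[i])
    (hermA : A \is hermsymmx) (hermB : B \is hermsymmx)
    (ona : orthonormal_family a) (onb : orthonormal_family b)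
    (specA : A = \sum_(i : P) (alpha i)%:C *: ketbra (a i) (a i))
    (specB : B = \sum_(j : P) (beta j)%:C *: ketbra (b j) (b j))
    (defC : forall i j : P, C i j = inner (a i) (b j))
    (k : nat) (hk : (1 <= k <= d)%N) :
  ((lambda_sum k (A + B))%:E <=
   \big[maxe/-oo]_(ST : ksubset P k * ksubset P k |
                   (\det (subarray C ST.1 ST.2) != 0)%R)
     (\sum_(x in val ST.1) alpha x + \sum_(y in val ST.2) beta y)%R%:E)%E.
Proof.
have hermAB : A + B \is hermsymmx.
  apply/is_hermitianmxP; rewrite expr0 scale1r linearD map_mxD.
  move/is_hermitianmxP: hermA; rewrite expr0 scale1r => <-.
  by move/is_hermitianmxP: hermB; rewrite expr0 scale1r => <-.
have [_ kd] := andP hk.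
have [v onv vE] := lambda_sum_eigenvectors hermAB kd.
set big := (\big[_/_]_(_ | _) _)%E.
(* [big] is an extended real, a priori possibly [-oo], so the bound is stated for every real [m]
   above it. *)
have bound (m : R) : (big <= m%:E)%E -> lambda_sum k (A + B) <= m.
  move=> bm; rewrite -lecR vE.
  under eq_bigr => l _ do rewrite mulmxDl /inner mulmxDr mxE -/(inner _ _) -/(inner _ _).
  rewrite big_split /= specA specB.
  under [X in X + _]eq_bigr => l _ do rewrite inner_sum_ketbra.
  under [X in _ + X]eq_bigr => l _ do rewrite inner_sum_ketbra.
  apply: frame_trace_le => // f g nz.
  have [S [s fE]] := injective_ksubset_nth (minor_neq0_inj nz).
  have [T [t gE]] : exists (S : ksubset P k) (s : 'S_k), g =1 ksubset_nth S \o s.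
    by apply: injective_ksubset_nth; move: nz; rewrite -minor_tr; apply: minor_neq0_inj.
  rewrite -lee_fin; apply: le_trans bm.
  under eq_bigr => i _ do rewrite fE /=.
  under [X in _ + X]eq_bigr => i _ do rewrite gE /=.
  rewrite !sum_ksubset_nth; apply: (@le_bigmax_cond _ _ _ _ (S, T)) => /=.
  (* Up to the signs of [s] and [t] the minor is the determinant of the submatrix, so [(S, T)]
     enters the maximum. *)
  apply: contraNneq nz => ST0.
  rewrite (eq_minor _ fE gE (F' := C)) // minor_permr minor_perml.
  by rewrite -[minor _ _ _]/(\det (subarray C S T)) ST0 !mulr0.
rewrite leNgt; apply/negP; case E : big => [r| |] //.
- by rewrite lte_fin ltNge bound ?E.
(* If [big] were [-oo], every real [m] would qualify; one less than [lambda_sum] is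
   contradictory. *)
- move=> _; have /bound : (big <= (lambda_sum k (A + B) - 1)%:E)%E by rewrite E leNye.
  by rewrite lerDl oppr_ge0 ler10.
Qed.
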